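(* Let $L$ be a split Lie algebra over a field $\mathbb{K}$ with splitting Cartan subalgebra $H$ and symmetric root system $\Lambda$, and let $V$ be a weight module over $L$ with respect to $H$ with symmetric weight system $\mathcal{P}$. If $LV=V$ and $\mathcal{Z}(V)=0$, then $V$ is the direct sum of the weight submodules $V_{[\gamma]}$: $$V=\bigoplus_{[\gamma]\in\mathcal{P}/\sim}V_{[\gamma]}.$$
   Context: $\mathbb{K}$ is an arbitrary field; there are no restrictions on the dimensions of $L$ or $V$. Split Lie algebra: a splitting Cartan subalgebra $H$ of a Lie algebra $L$ is a maximal abelian subalgebra such that the maps $\mathrm{ad}_h$, $h\in H$, are simultaneously diagonalizable; $L$ is split if it has such an $H$. Then $L=H\oplus\bigoplus_{\alpha\in\Lambda}L_\alpha$, where for $\alpha\in H^*$, $L_\alpha=\{x\in L:[h,x]=\alpha(h)x\ \forall h\in H\}$ and $\Lambda=\{\alpha\in H^*\setminus\{0\}:L_\alpha\neq0\}$ (and $L_0=H$). $\Lambda$ is symmetric if $\alpha\in\Lambda$ implies $-\alpha\in\Lambda$. Weight module: an $L$-module $V$ (so $[x,y]v=x(yv)-y(xv)$) is a weight module with respect to $H$ if $V=V_0\oplus\bigoplus_{\gamma\in\mathcal{P}}V_\gamma$, where $V_\gamma=\{v\in V:hv=\gamma(h)v\ \forall h\in H\}$ for $\gamma\in H^*$ and $\mathcal{P}=\{\gamma\in H^*\setminus\{0\}:V_\gamma\neq0\}$. $\mathcal{P}$ is symmetric if $\gamma\in\mathcal{P}$ implies $-\gamma\in\mathcal{P}$.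 A weight submodule is a submodule which is itself a weight module. For subspaces $A\subset L$, $B\subset V$, $AB$ is the linear span of all products $ab$. $\mathcal{Z}(V)=\{v\in V:Lv=0\}$. Connection of weights: for $\gamma,\delta\in\mathcal{P}$, $\gamma$ is connected to $\delta$, written $\gamma\sim\delta$, if either $\delta\in\{\gamma,-\gamma\}$, or there exist $n\ge1$ and $\alpha_1,\dots,\alpha_n\in\Lambda$ such that $\gamma+\alpha_1,\ \gamma+\alpha_1+\alpha_2,\ \dots,\ \gamma+\alpha_1+\cdots+\alpha_{n-1}\in\mathcal{P}$ and $\gamma+\alpha_1+\cdots+\alpha_n\in\{\delta,-\delta\}$ (sums in $H^*$). The relation $\sim$ is an equivalence relation on $\mathcal{P}$; $\mathcal{P}_\gamma=[\gamma]$ denotes the class of $\gamma$, and $$V_{[\gamma]}=V_{\mathcal{P}_\gamma}:=\Big(\sum_{\alpha\in\Lambda\cap\mathcal{P}_\gamma}L_{-\alpha}V_\alpha\Big)\oplus\Big(\bigoplus_{\delta\in\mathcal{P}_\gamma}V_\delta\Big),$$ which is a weight submodule of $V$. *)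

(* Defs.v *)
From HB Require Import structures.
From mathcomp Require Import all_boot all_algebra.
From mathcomp Require Import boolp classical_sets functions.

Set Implicit Arguments.
Unset Strict Implicit.
Unset Printing Implicit Defensive.

Import GRing.Theory.

Local Open Scope classical_set_scope.
Local Open Scope ring_scope.

Section LinearAlgebra.
Variables (K : fieldType) (M : lmodType K).
Implicit Types X B A C W : set M.

Definition subspace W :=
  W 0 /\ forall (a : K) x y, W x -> W y -> W (a *: x + y).

Definition lin_span X : set M :=
  [set v | exists (n : nat) (c : 'I_n -> K) (x : 'I_n -> M),
     (forall i, X (x i)) /\ v = \sum_(i < n) c i *: x i].

Definition lin_indep X :=
  forall (n : nat) (c : 'I_n -> K) (x : 'I_n -> M),
    injective x -> (forall i, X (x i)) ->
    \sum_(i < n) c i *: x i = 0 -> forall i, c i = 0.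

Definition is_basis X := lin_span X = [set: M] /\ lin_indep X.

Definition add_sub A C : set M :=
  [set v | exists a c, [/\ A a, C c & v = a + c]].

(* D is the set of indices, possibly infinite. *)
Definition sum_sub (I : Type) (D : set I) (F : I -> set M) : set M :=
  lin_span (\bigcup_(i in D) F i).

(* W is the internal direct sum of the subspaces F i, for i in D. *)
Definition is_direct_sum (I : Type) (D : set I) (F : I -> set M) W :=
  sum_sub D F = W /\
  forall i, D i -> F i `&` sum_sub (D `\ i) F = [set 0].

End LinearAlgebra.

HB.mixin Record Lmodule_isLie (K : fieldType) L of GRing.Lmodule K L := {
  lie : L -> L -> L;
  lie_linearl : forall y, linear (lie^~ y);
  lie_linearr : forall x, linear (lie x);
  lie_xx : forall x, lie x x = 0;
  lie_jacobi : forall x y z,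
    lie x (lie y z) + lie y (lie z x) + lie z (lie x y) = 0
}.

#[short(type="lieAlgType")]
HB.structure Definition LieAlgebra (K : fieldType) :=
  {L of GRing.Lmodule K L & Lmodule_isLie K L}.

HB.mixin Record Lmodule_isLieModule (K : fieldType) (L : lieAlgType K) V
    of GRing.Lmodule K V := {
  lact : L -> V -> V;
  lact_linearl : forall v, linear (lact^~ v);
  lact_linearr : forall x, linear (lact x);
  lact_lie : forall x y v,
    lact (lie x y) v = lact x (lact y v) - lact y (lact x v)
}.

#[short(type="lieModType")]
HB.structure Definition LieModule (K : fieldType) (L : lieAlgType K) :=
  {V of GRing.Lmodule K V & Lmodule_isLieModule K L V}.

Section SplittingCartan.
Variables (K : fieldType) (L : lieAlgType K).
Implicit Types A : set L.

Definition abelian_subalgebra A :=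
  [/\ subspace A, forall x y, A x -> A y -> A (lie x y)
    & forall x y, A x -> A y -> lie x y = 0].

Definition max_abelian_subalgebra A :=
  abelian_subalgebra A /\
  forall A', abelian_subalgebra A' -> A `<=` A' -> A' = A.

Definition simultaneously_diagonalizable_ad A :=
  exists B : set L, is_basis B /\
    forall b, B b -> forall h, A h -> exists c : K, lie h b = c *: b.

Definition splitting_cartan A :=
  max_abelian_subalgebra A /\ simultaneously_diagonalizable_ad A.

End SplittingCartan.

Section Weights.
Variables (K : fieldType) (L : lieAlgType K).
(* The Cartan subalgebra: the subspace HS of L, and H, the same subspace as a
   type; val : H -> L is the inclusion. *)
Variables (HS : {pred L}) (H : subLmodType HS).
Variable V : lieModType L.

(* H^*, inside the group of all functions H -> K with pointwise operations *)
Definition dual : set (H -> K) := [set f | scalar f].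

Definition root_space (alpha : H -> K) : set L :=
  [set x | forall h : H, lie (val h) x = alpha h *: x].

Definition root_system : set (H -> K) :=
  [set alpha | [/\ dual alpha, alpha <> 0 & root_space alpha <> [set 0]]].

Definition weight_space (W : set V) (gamma : H -> K) : set V :=
  [set v | W v /\ forall h : H, lact (val h) v = gamma h *: v].

Definition weight_system (W : set V) : set (H -> K) :=
  [set gamma |
    [/\ dual gamma, gamma <> 0 & weight_space W gamma <> [set 0]]].

(* W = W_0 (+) (+)_(gamma a weight of W) W_gamma; for the module V itself, take
   W = [set: V]. *)
Definition is_weight_module (W : set V) :=
  is_direct_sum (0 |` weight_system W) (weight_space W) W.

Definition submodule (W : set V) :=
  subspace W /\ forall (x : L) v, W v -> W (lact x v).

Definition weight_submodule (W : set V) := submodule W /\ is_weight_module W.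

Definition symmetric_set (S : set (H -> K)) := forall f, S f -> S (- f).

(* The product AB is the span of the products ab, not just their set. *)
Definition prod_sub (A : set L) (B : set V) : set V :=
  lin_span [set lact a b | a in A & b in B].

Definition module_center : set V := [set v | forall x : L, lact x v = 0].

Local Notation Lambda := root_system.
Local Notation P := (weight_system [set: V]).
Local Notation V_ := (weight_space [set: V]).

(* s lists the roots alpha_1, ..., alpha_n, with n >= 1. *)
Definition wt_connected_by (s : seq (H -> K)) (gamma delta : H -> K) :=
  [/\ (0 < size s)%N,
      forall a, a \in s -> Lambda a,
      forall k, (0 < k < size s)%N -> P (gamma + \sum_(a <- take k s) a)
    & gamma + \sum_(a <- s) a = delta \/ gamma + \sum_(a <- s) a = - delta].

Definition wt_connected (gamma delta : H -> K) :=
  [\/ delta = gamma, delta = - gamma | exists s, wt_connected_by s gamma delta].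

Definition weight_class (gamma : H -> K) : set (H -> K) :=
  [set delta | P delta /\ wt_connected gamma delta].

(* The quotient of P by connection, as a set of subsets of P. *)
Definition weight_classes : set (set (H -> K)) :=
  [set weight_class gamma | gamma in P].

(* V_C for a class C. When V is a weight module, the two summands are in direct
   sum, since the first one is contained in V_0. *)
Definition class_module (C : set (H -> K)) : set V :=
  add_sub
    (sum_sub (Lambda `&` C)
       (fun alpha => prod_sub (root_space (- alpha)) (V_ alpha)))
    (sum_sub C V_).

End Weights.

Arguments dual {K L HS} H _.
Arguments root_system {K L HS} H _.
Arguments weight_system {K L HS} H {V} W _.
Arguments weight_classes {K L HS} H V _.
Arguments module_center {K L} V _.
Arguments class_module {K L HS} H V C _.

(* Main.v *)
Require Import Defs.
From HB Require Import structures.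
From mathcomp Require Import all_boot all_algebra.
From mathcomp Require Import boolp classical_sets functions.

(** A nonzero weight vector moves within one class of weights under the root
    spaces, except when it lands in [V_0]; this makes each [V_C] a submodule.
    Since [L_0 = H] kills [V_0], the products of homogeneous elements that land
    in [V_0] come from [L_(-a) V_a], so [LV = V] puts everything in the sum of
    the [V_C].  A vector lying both in [V_C] and in the sum of the other [V_D]
    has weight [0] because classes are disjoint; applying a root vector yields
    a vector of nonzero weight in the same two submodules, hence zero.  Thus
    the intersection lies in the center of [V]. *)

Set Implicit Arguments.
Unset Strict Implicit.
Unset Printing Implicit Defensive.

Import GRing.Theory.

Local Open Scope classical_set_scope.
Local Open Scope ring_scope.

(** * Subspaces, spans and direct sums of arbitrary families *)

Section Subspaces.
Variables (K : fieldType) (M : lmodType K).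
Implicit Types (W X A B : set M).

Lemma subspaceZ W a x : subspace W -> W x -> W (a *: x).
Proof. by case=> W0 WL Wx; rewrite -[_ *: _]addr0; apply: WL. Qed.

Lemma subspaceD W x y : subspace W -> W x -> W y -> W (x + y).
Proof. by case=> _ WL Wx Wy; rewrite -[x]scale1r; apply: WL. Qed.

Lemma subspaceB W x y : subspace W -> W x -> W y -> W (x - y).
Proof. by case=> _ WL Wx Wy; rewrite addrC -scaleN1r; apply: WL. Qed.

Lemma subspace_sum W (I : Type) (r : seq I) (p : pred I) (F : I -> M) :
  subspace W -> (forall i, p i -> W (F i)) -> W (\sum_(i <- r | p i) F i).
Proof.
move=> sW WF; elim/big_rec: _ => [|i x pi Wx]; first by case: sW.
by apply: subspaceD => //; apply: WF.
Qed.

Lemma subspace_preimage (N : lmodType K) (f : N -> M) W :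
  linear f -> subspace W -> subspace (f @^-1` W).
Proof.
move=> fL [W0 WL]; split=> [|a x y Wx Wy] /=; last by rewrite fL; apply: WL.
by have := fL (-1) 0 0; rewrite scaler0 addr0 scaleN1r addNr => ->.
Qed.

Lemma lin_span_sub X : X `<=` lin_span X.
Proof.
move=> x Xx; exists 1%N, (fun=> 1), (fun=> x); split=> //.
by rewrite big_ord1 scale1r.
Qed.

Lemma lin_span_min X W : subspace W -> X `<=` W -> lin_span X `<=` W.
Proof.
move=> sW XW v [n [c [x [Xx ->]]]]; apply: subspace_sum => // i _.
by apply: subspaceZ => //; apply: XW.
Qed.

Lemma subspace_span X : subspace (lin_span X).
Proof.
split=> [|a _ _ [m [c [x [Xx ->]]]] [n [d [y [Xy ->]]]]].
  by exists 0%N, (fun=> 0), (fun=> 0); split=> [[]//|]; rewrite big_ord0.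
exists (m + n)%N,
  (fun i : 'I_(m + n) =>
     match fintype.split i with inl j => a * c j | inr j => d j end),
  (fun i : 'I_(m + n) =>
     match fintype.split i with inl j => x j | inr j => y j end).
split=> [i|]; first by case: (fintype.split i).
rewrite big_split_ord scaler_sumr; congr (_ + _); apply: eq_bigr => i _.
  by rewrite (unsplitK (inl _)) scalerA.
by rewrite (unsplitK (inr _)).
Qed.

Lemma lin_span0 X : lin_span X 0.
Proof. by case: (subspace_span X). Qed.

Lemma add_sub_min A B W :
  subspace W -> A `<=` W -> B `<=` W -> add_sub A B `<=` W.
Proof.
by move=> sW AW BW _ [a [b [/AW ? /BW ? ->]]]; apply: subspaceD.
Qed.

Lemma subspace_add A B : subspace A -> subspace B -> subspace (add_sub A B).
Proof.
move=> sA sB; split=> [|a _ _ [x1 [y1 [? ? ->]]] [x2 [y2 [? ? ->]]]].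
  by exists 0, 0; rewrite addr0; split=> //; [case: sA | case: sB].
exists (a *: x1 + x2), (a *: y1 + y2); rewrite scalerDr addrACA; split=> //.
  by case: sA => _; apply.
by case: sB => _; apply.
Qed.

Lemma add_subl A B : subspace B -> A `<=` add_sub A B.
Proof. by case=> B0 _ x Ax; exists x, 0; rewrite addr0. Qed.

Lemma add_subr A B : subspace A -> B `<=` add_sub A B.
Proof. by case=> A0 _ x Bx; exists 0, x; rewrite add0r. Qed.

Lemma subspace0 : subspace [set (0 : M)].
Proof. by split=> // a x y -> ->; rewrite scaler0 addr0. Qed.

Lemma subspace_ker (N : lmodType K) (f : N -> M) :
  linear f -> subspace [set x | f x = 0].
Proof. by move=> fL; apply: (subspace_preimage fL subspace0). Qed.

Section Sums.
Variables (I : Type) (F : I -> set M).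
Implicit Types D : set I.

Lemma sum_sub_sub D i : D i -> F i `<=` sum_sub D F.
Proof. by move=> Di x Fx; apply: lin_span_sub; exists i. Qed.

Lemma sum_sub_min D W :
  subspace W -> (forall i, D i -> F i `<=` W) -> sum_sub D F `<=` W.
Proof. by move=> sW FW; apply: lin_span_min => // x [i Di]; apply: FW. Qed.

Lemma sum_subS D D' : D `<=` D' -> sum_sub D F `<=` sum_sub D' F.
Proof.
move=> sDD'; apply: sum_sub_min => [|i Di]; first exact: subspace_span.
by apply: sum_sub_sub; apply: sDD'.
Qed.

End Sums.

(** Terms of a linear combination that come from the same [F i] are grouped together. With distinct
    indices, a single component can be isolated and compared with the others. *)
Lemma sum_sub_uniq (I : eqType) (D : set I) (F : I -> set M) v :
  (forall i, subspace (F i)) -> sum_sub D F v ->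
  exists (s : seq I) (f : I -> M),
    [/\ uniq s, forall i, i \in s -> D i, forall i, F i (f i)
      & v = \sum_(i <- s) f i].
Proof.
move=> sF [n [c [x [Ux ->]]]].
have /choice[k kP] : forall j, exists i, D i /\ F i (x j).
  by move=> j; have [i Di Fx] := Ux j; exists i.
exists (undup [seq k j | j <- enum 'I_n]),
  (fun i => \sum_(j | k j == i) c j *: x j).
split=> [|i|i|]; first exact: undup_uniq.
- by rewrite mem_undup => /mapP[j _ ->]; case: (kP j).
- apply: subspace_sum => // j /eqP <-.
  by apply: subspaceZ => //; case: (kP j).
(* After the exchange, the term of [j] is summed over the indices equal to [k j], and there is
   exactly one in the duplicate-free list. *)
rewrite (exchange_big_dep xpredT) //=; apply: eq_bigr => j _.
rewrite -big_filter.
rewrite (_ : [seq i <- _ | _] = [:: k j]) ?big_seq1 //.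
rewrite (eq_filter (a2 := pred1 (k j))) => [|i]; last by rewrite /= eq_sym.
by rewrite filter_pred1_uniq ?undup_uniq // mem_undup map_f // mem_enum.
Qed.

(** Each component [f i] of [v] along [S] equals [v] minus the other components. As [v] is also a
    sum over [T], which avoids [i], this difference lies in the sum over the indices other than [i],
    and directness makes [f i] zero. *)
Lemma direct_sum_disjoint (I : eqType) (D S T : set I) (F : I -> set M) W v :
  (forall i, subspace (F i)) -> is_direct_sum D F W ->
  S `<=` D -> T `<=` D -> S `&` T `<=` set0 ->
  sum_sub S F v -> sum_sub T F v -> v = 0.
Proof.
move=> sF [_ dF] SD TD ST /(sum_sub_uniq sF)[s [f [us sS Ff ->]]] Tv.
rewrite big_seq big1 // => i si.
have Di : D i by apply/SD/sS.
have sV := @subspace_span (\bigcup_(j in D `\ i) F j).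
suff : (F i `&` sum_sub (D `\ i) F) (f i) by rewrite dF.
split=> //.
rewrite -[f i](addrK (\sum_(j <- s | j != i) f j)) -(bigD1_seq i) //=.
apply: subspaceB => //.
  apply: sum_subS Tv => j Tj; split; first exact: TD.
  by move=> ji; apply: (ST i); split; [apply: sS | rewrite -ji].
rewrite big_seq_cond; apply: subspace_sum => // j /andP[sj ji].
apply: (@sum_sub_sub _ _ _ j); last exact: Ff.
by split; [apply/SD/sS | move=> /= jE; rewrite jE eqxx in ji].
Qed.

End Subspaces.

(** * Root vectors, weight vectors and the action of the former on the latter *)

Section WeightModules.
Variables (K : fieldType) (L : lieAlgType K) (HS : {pred L}).
Variables (H : subLmodType HS) (V : lieModType L).

Local Notation Lambda := (root_system H).
Local Notation P := (weight_system H [set: V]).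
Local Notation V_ := (weight_space (H := H) [set: V]).
Implicit Types (alpha beta gamma delta : H -> K) (C : set (H -> K)).
Implicit Types (W : set V) (x y : L) (v : V).

Lemma subspace_lact x W : subspace W -> subspace [set v | W (lact x v)].
Proof. exact: (subspace_preimage (lact_linearr x)). Qed.

Lemma subspace_lact_l v W : subspace W -> subspace [set x | W (lact x v)].
Proof. exact: (subspace_preimage (lact_linearl v)). Qed.

Lemma lact0r x : lact x (0 : V) = 0.
Proof. by case: (@subspace_ker _ V V _ (lact_linearr x)). Qed.

Lemma lact0l v : lact 0 v = 0.
Proof. by case: (subspace_ker (lact_linearl v)). Qed.

Lemma lactZr x a v : lact x (a *: v) = a *: lact x v.
Proof. by rewrite -[a *: v]addr0 lact_linearr lact0r addr0. Qed.

Lemma lactZl x a v : lact (a *: x) v = a *: lact x v.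
Proof. by rewrite -[a *: x]addr0 lact_linearl lact0l addr0. Qed.

Lemma lieZr x a y : lie x (a *: y) = a *: lie x y.
Proof.
have [/= l0 _] := subspace_ker (lie_linearr x).
by rewrite -[a *: y]addr0 lie_linearr l0 addr0.
Qed.

Lemma lie_anticomm x y : lie x y = - lie y x.
Proof.
have lD (z t u : L) : lie z (t + u) = lie z t + lie z u.
  by rewrite -[t in LHS]scale1r lie_linearr scale1r.
have rD (z t u : L) : lie (t + u) z = lie t z + lie u z.
  by rewrite -[t in LHS]scale1r lie_linearl scale1r.
apply/eqP; rewrite -addr_eq0; apply/eqP.
by have := lie_xx (x + y); rewrite lD !rD !lie_xx add0r addr0 addrC.
Qed.

Lemma subspace_weight_space W gamma :
  subspace W -> subspace (weight_space W gamma).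
Proof.
move=> [W0 WL]; split=> [|a u v [Wu hu] [Wv hv]].
  by split=> // h; rewrite lact0r scaler0.
split=> [|h]; first exact: WL.
by rewrite lact_linearr hu hv scalerDr !scalerA mulrC.
Qed.

Lemma subspace_V gamma : subspace (V_ gamma).
Proof. exact: subspace_weight_space. Qed.

(** A nonzero common eigenvector transfers linearity from the action to its eigenvalue. Hence a
    nonzero vector with a nonzero eigenvalue function is enough to exhibit a root or a weight. *)
Lemma eigenvalue_linear (N : lmodType K) (f : H -> N -> N) gamma (u : N) :
  (forall a h k, f (a *: h + k) u = a *: f h u + f k u) ->
  u <> 0 -> (forall h, f h u = gamma h *: u) -> dual H gamma.
Proof.
move=> fL /eqP/negPf u0 hu a h k; apply/eqP; rewrite -subr_eq0.
suff : (gamma (a *: h + k) - (a * gamma h + gamma k)) *: u == 0.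
  by rewrite scaler_eq0 u0 orbF.
by rewrite scalerBl scalerDl -scalerA -!hu fL subrr.
Qed.

Lemma weight_systemI W gamma v :
  weight_space W gamma v -> v <> 0 -> gamma <> 0 -> weight_system H W gamma.
Proof.
move=> Wv v0 g0; split=> //; last by move=> E; apply: v0; rewrite E in Wv.
apply: (eigenvalue_linear (f := fun h => lact (val h)) _ v0 (proj2 Wv)).
by move=> a h k; rewrite linearP lact_linearl.
Qed.

Lemma root_systemI alpha x :
  root_space alpha x -> x <> 0 -> alpha <> 0 -> Lambda alpha.
Proof.
move=> Lx x0 a0; split=> //; last by move=> E; apply: x0; rewrite E in Lx.
apply: (eigenvalue_linear (f := fun h => lie (val h)) _ x0 Lx).
by move=> a h k; rewrite linearP lie_linearl.
Qed.

Lemma lact_weight alpha gamma x v :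
  root_space alpha x -> V_ gamma v -> V_ (alpha + gamma) (lact x v).
Proof.
move=> Lx [_ hv]; split=> // h; rewrite addrC.
have -> : lact (val h) (lact x v) =
    lact (lie (val h) x) v + lact x (lact (val h) v).
  by rewrite lact_lie subrK.
by rewrite Lx hv lactZl lactZr -scalerDl addrC.
Qed.

(** The Jacobi identity makes [lie (val h)] a derivation, so eigenvalues add up. *)
Lemma lie_root alpha beta x y :
  root_space alpha x -> root_space beta y ->
  root_space (alpha + beta) (lie x y).
Proof.
move=> Lx Ly h; have := lie_jacobi (val h) x y.
rewrite (lie_anticomm y) Ly -scaleNr Lx !lieZr (lie_anticomm y x) scalerN.
rewrite -scaleNr -addrA -scalerDl -opprD scaleNr => /eqP.
by rewrite subr_eq0 addrC => /eqP.
Qed.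

Lemma weight_zero_or gamma v : gamma <> 0 -> V_ gamma v -> v = 0 \/ P gamma.
Proof.
move=> g0 Vv; have [->|/eqP v0] := eqVneq v 0; first by left.
by right; apply: weight_systemI Vv v0 g0.
Qed.

Lemma weight_space_sum W gamma :
  weight_space W gamma `<=` sum_sub (0 |` weight_system H W) (weight_space W).
Proof.
move=> v Wv; have [->|/eqP v0] := eqVneq v 0.
  exact: lin_span0.
apply: (@sum_sub_sub _ _ _ _ _ gamma) => //.
have [->|/eqP g0] := eqVneq gamma 0; first by left.
by right; apply: weight_systemI Wv v0 g0.
Qed.

Lemma disjoint_weights (S T : set (H -> K)) v :
  is_weight_module H [set: V] -> S `<=` 0 |` P -> T `<=` 0 |` P ->
  S `&` T `<=` set0 -> sum_sub S V_ v -> sum_sub T V_ v -> v = 0.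
Proof. by apply: direct_sum_disjoint => gamma; apply: subspace_V. Qed.

(** * The splitting Cartan subalgebra and generation of [L] by root vectors *)

Section Cartan.
Hypothesis H_cartan : splitting_cartan [set x : L | x \in HS].

Lemma cartan_weight0 (h : H) v : V_ 0 v -> lact (val h) v = 0.
Proof. by case=> _ ->; rewrite scale0r. Qed.

Lemma root_space0 x : root_space (H := H) 0 x -> exists h : H, x = val h.
Proof.
move=> Lx; have [[[sH clH abH] maxH] _] := H_cartan.
have hx y : y \in HS -> lie y x = 0.
  by move=> Hy; have := Lx (Sub y Hy); rewrite SubK scale0r.
have hyx y : y \in HS -> lie x y = 0.
  by move=> Hy; rewrite lie_anticomm hx // oppr0.
(* [H + K x] is abelian, hence equal to [H] by maximality. *)
pose A := add_sub [set y | y \in HS] (lin_span [set x]).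
have sA : subspace A by apply: subspace_add => //; exact: subspace_span.
(* Vanishing of the bracket is linear in each argument, so it is checked when each of [y] and [z] is
   either in [HS] or equal to [x]. *)
have comm y z : A y -> A z -> lie y z = 0.
  have sub_r (t : L) : subspace [set u | lie t u = 0].
    exact: (subspace_ker (lie_linearr t)).
  have sub_l (t : L) : subspace [set u | lie u t = 0].
    exact: (subspace_ker (lie_linearl t)).
  move=> Ay Az; apply: (add_sub_min (sub_l z) _ _ Ay) => [{Ay} {}y Hy|].
    apply: (add_sub_min (sub_r y) _ _ Az) => [{Az} {}z Hz|]; first exact: abH.
    by apply: (lin_span_min (sub_r y)) => _ ->; apply: hx.
  apply: (lin_span_min (sub_l z)) => _ ->.
  apply: (add_sub_min (sub_r x) _ _ Az) => [{Az} {}z Hz|]; first exact: hyx.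
  by apply: (lin_span_min (sub_r x)) => _ ->; apply: lie_xx.
have AE : A = [set y | y \in HS].
  apply: maxH; last by apply: add_subl; exact: subspace_span.
  split=> // y z Ay Az; rewrite comm //; by case: sA.
suff : A x by rewrite AE => /= Hx; exists (Sub x Hx); rewrite SubK.
by apply: add_subr => //; apply: lin_span_sub.
Qed.

(** A basis that diagonalizes the action of the Cartan subalgebra consists of root vectors and of
    vectors of root zero, and the latter lie in [H] by [root_space0]. Linear claims about all of [L]
    are reduced to these two kinds of elements. *)
Lemma lie_algebra_ind (Q : set L) :
  subspace Q -> (forall h : H, Q (val h)) ->
  (forall alpha, Lambda alpha -> root_space alpha `<=` Q) -> forall x, Q x.
Proof.
move=> sQ QH QL x; have [_ [B [[spanB _] diagB]]] := H_cartan.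
suff BQ : B `<=` Q by apply: (lin_span_min sQ BQ); rewrite spanB.
move=> b Bb.
(* The eigenvalues of [b], chosen separately for each [h], form a mere function [alpha]; its
   linearity comes later from [b] being nonzero. *)
have /choice[alpha Lb] : forall h : H, exists c : K, lie (val h) b = c *: b.
  by move=> h; apply: (diagB b Bb); apply: valP.
have [->|/eqP b0] := eqVneq b 0; first by case: sQ.
have [a0|/eqP a0] := eqVneq alpha 0.
  by rewrite a0 in Lb; have [h ->] := root_space0 Lb.
exact: (QL alpha (root_systemI Lb b0 a0)).
Qed.

End Cartan.

(** Step-closed sets replace the equivalence relation [~]: their complements are
    step-closed too, and a class is the least step-closed set around its weight,
    so classes that meet coincide. *)
Definition step_closed (Q : set (H -> K)) :=
  (forall delta, P delta -> Q delta -> Q (- delta)) /\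
  (forall delta alpha, P delta -> Q delta -> Lambda alpha ->
     P (delta + alpha) -> Q (delta + alpha)).

(** * Classes of connected weights *)

Section Classes.
Hypothesis roots_sym : symmetric_set Lambda.
Hypothesis weights_sym : symmetric_set P.

(** Steps are reversible: by symmetry of the roots, adding [alpha] is undone by adding the root
    [- alpha]. *)
Lemma step_closedC Q : step_closed Q -> step_closed (~` Q).
Proof.
move=> [QN QD]; split=> [delta Pd nQd QNd|delta alpha Pd nQd La Pda Qda].
  by apply: nQd; rewrite -[delta]opprK; apply: QN => //; apply: weights_sym.
apply: nQd; rewrite -[delta](addrK alpha).
by apply: QD => //; [apply: roots_sym | rewrite addrK].
Qed.

(** Induction along the partial sums of a connecting chain keeps them in [Q]; the last one is
    [delta] or [- delta]. *)
Lemma weight_class_min Q gamma :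
  step_closed Q -> P gamma -> Q gamma -> weight_class V gamma `<=` Q.
Proof.
move=> [QN QD] Pg Qg delta [Pd]; case=> [->//|->|]; first exact: QN.
move=> [s [_ sL sP sE]].
(* Connection only requires the proper partial sums to be weights; the full sum is one because
   [delta] is, up to sign. *)
have Ps : P (gamma + \sum_(a <- s) a).
  by case: sE => ->; [|apply: weights_sym].
suff Qs k : (k <= size s)%N -> P (gamma + \sum_(a <- take k s) a) /\
    Q (gamma + \sum_(a <- take k s) a).
  have [_] := Qs _ (leqnn _); rewrite take_size.
  by case: sE => -> // /(QN _ (weights_sym Pd)); rewrite opprK.
elim: k => [|k IH ks]; first by rewrite take0 big_nil addr0.
have [Pk Qk] := IH (ltnW ks).
have Pk1 : P (gamma + \sum_(a <- take k.+1 s) a).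
  move: ks; rewrite leq_eqVlt => /orP[/eqP ->|ks]; first by rewrite take_size.
  by apply: sP; rewrite ks.
split=> //; move: Pk1; rewrite (take_nth 0 ks) -cats1 big_cat big_seq1 addrA.
by apply: QD => //; apply/sL/mem_nth.
Qed.

Lemma step_closed_class gamma : P gamma -> step_closed (weight_class V gamma).
Proof.
move=> Pg; split=> [delta Pd [_ cd]|delta alpha Pd [_ cd] La Pda].
  split; first exact: weights_sym.
  case: cd => [->|->|[s [s0 sL sP sE]]]; [by apply: Or32 | |].
    by apply: Or31; rewrite opprK.
  by apply: Or33; exists s; split=> //; rewrite opprK; case: sE; [right|left].
(* The cases [delta = gamma] and [delta = - gamma] become an empty chain, so that all cases are
   extended alike; appending a root makes the chain nonempty again. *)
have [s [sL sP sE]] : exists s, [/\ forall a, a \in s -> Lambda a,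
    forall k, (0 < k < size s)%N -> P (gamma + \sum_(a <- take k s) a)
    & gamma + \sum_(a <- s) a = delta \/ gamma + \sum_(a <- s) a = - delta].
  case: cd => [->|->|[s [_ ? ? ?]]]; last by exists s.
    by exists [::]; split=> // [[]//|]; rewrite big_nil addr0; left.
  by exists [::]; split=> // [[]//|]; rewrite big_nil addr0 opprK; right.
have Ps : P (gamma + \sum_(a <- s) a).
  by case: sE => ->; [|apply: weights_sym].
split=> //; apply: Or33.
have ext beta : Lambda beta ->
    gamma + \sum_(a <- s) a + beta = delta + alpha \/
    gamma + \sum_(a <- s) a + beta = - (delta + alpha) ->
  wt_connected_by V (rcons s beta) gamma (delta + alpha).
  move=> Lb sbE; split; first by rewrite size_rcons.
  - by move=> a; rewrite mem_rcons inE => /predU1P[->|/sL].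
  - move=> k; rewrite size_rcons ltnS => /andP[k0].
    rewrite leq_eqVlt -cats1 => /orP[/eqP ->|ks].
      by rewrite take_size_cat.
    by rewrite takel_cat 1?ltnW //; apply: sP; rewrite k0.
  - by rewrite -cats1 big_cat big_seq1 addrA.
case: sE => sE.
  by exists (rcons s alpha); apply: ext => //; rewrite sE; left.
(* This chain ends at [- delta], so the step is mirrored: appending [- alpha] leads to
   [- (delta + alpha)]. *)
exists (rcons s (- alpha)); apply: ext; first exact: roots_sym.
by rewrite sE opprD; right.
Qed.

(** If [gamma] were outside the class of [gamma'], minimality applied to the step-closed complement
    would put [delta] outside as well. So [gamma] is inside, minimality gives one inclusion, and the
    roles can be exchanged. *)
Lemma weight_class_eq gamma gamma' delta : P gamma -> P gamma' ->
  weight_class V gamma delta -> weight_class V gamma' delta ->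
  weight_class V gamma = weight_class V gamma'.
Proof.
have sub g g' : P g -> P g' -> weight_class V g delta ->
    weight_class V g' delta -> weight_class V g `<=` weight_class V g'.
  move=> Pg Pg' gd g'd; apply: weight_class_min => //.
    exact: step_closed_class.
  have ncl := step_closedC (step_closed_class Pg').
  by apply: contrapT => /(weight_class_min ncl Pg)/(_ _ gd).
by move=> Pg Pg' gd g'd; rewrite eqEsubset; split; apply: sub.
Qed.

End Classes.

(** * Generators and weights of the subspaces [class_module H V C] *)

Lemma subspace_class_module C : subspace (class_module H V C).
Proof. by apply: subspace_add; exact: subspace_span. Qed.

Lemma class_module_min C W : subspace W ->
  (forall alpha x v, Lambda alpha -> C alpha -> root_space (- alpha) x ->
     V_ alpha v -> W (lact x v)) ->
  (forall delta, C delta -> V_ delta `<=` W) -> class_module H V C `<=` W.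
Proof.
move=> sW WL WV; apply: add_sub_min => //; apply: sum_sub_min => //.
move=> alpha [La Ca]; apply: lin_span_min => // _ [x Lx [v Vv <-]].
exact: (WL alpha).
Qed.

Lemma class_module_weight C delta : C delta -> V_ delta `<=` class_module H V C.
Proof.
move=> Cd v Vv; apply: add_subr; first exact: subspace_span.
exact: sum_sub_sub Vv.
Qed.

Lemma class_module_prod C alpha x v : Lambda alpha -> C alpha ->
  root_space (- alpha) x -> V_ alpha v -> class_module H V C (lact x v).
Proof.
move=> La Ca Lx Vv; apply: add_subl; first exact: subspace_span.
apply: (@sum_sub_sub _ _ _ _ _ alpha) => //.
by apply: lin_span_sub; exists x => //; exists v.
Qed.

Lemma lact_opp_weight alpha x v :
  root_space (- alpha) x -> V_ alpha v -> V_ 0 (lact x v).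
Proof. by move=> Lx Vv; rewrite -(addNr alpha); apply: lact_weight. Qed.

(** The products of [root_space (- alpha)] with [V_ alpha] have weight zero, so only zero and the
    elements of [C] occur as weights. *)
Lemma class_module_sum C :
  class_module H V C `<=` sum_sub (0 |` C) V_.
Proof.
apply: class_module_min => [|alpha x v _ _ Lx Vv|delta Cd].
- exact: subspace_span.
- by apply: (sum_sub_sub (i := 0)); [left|apply: lact_opp_weight Lx Vv].
- by apply: sum_sub_sub; right.
Qed.

(** * Submodule property, weight decomposition, independence and generation *)

Section ClassModules.
Hypothesis H_cartan : splitting_cartan [set x : L | x \in HS].
Hypothesis roots_sym : symmetric_set Lambda.
Hypothesis V_weight : is_weight_module H [set: V].
Hypothesis weights_sym : symmetric_set P.

Lemma submodule_class_module C :
  C `<=` P -> step_closed C -> submodule (class_module H V C).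
Proof.
move=> CP [CN CD]; have sW := subspace_class_module C.
have W0 : class_module H V C 0 by case: sW.
split=> // x v Wv; move: x.
apply: (lie_algebra_ind H_cartan); first exact: subspace_lact_l.
  move=> h; move: v Wv; apply: class_module_min; first exact: subspace_lact.
    move=> alpha x v _ _ Lx Vv.
    by rewrite /= (cartan_weight0 h (lact_opp_weight Lx Vv)).
  move=> delta Cd v Vv /=; case: (Vv) => _ ->; apply: subspaceZ => //.
  exact: class_module_weight Vv.
move=> beta Lb x Lx; move: v Wv; apply: class_module_min.
- exact: subspace_lact.
(* Here [x] acts on a product [lact y v] of weight zero. The result has weight [beta], so if it is
   nonzero it remains to reach [beta] from [alpha] inside [C]. *)
- move=> alpha y v La Ca Ly Vv /=.
  have b0 : beta <> 0 by case: Lb.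
  have [->//|xyv0] := eqVneq (lact x (lact y v)) 0.
  have Vb : V_ beta (lact x (lact y v)).
    by rewrite -[beta]addr0; apply/lact_weight/(lact_opp_weight Ly).
  have Pb : P beta by apply: weight_systemI Vb _ b0; apply/eqP.
  apply: (@class_module_weight _ beta) => //.
  have xyE : lact x (lact y v) = lact (lie x y) v + lact y (lact x v).
    by rewrite lact_lie subrK.
  (* If this term vanishes, [lact (lie x y) v] does not, so [beta - alpha] is zero or a root and
     [beta] is at most one step from [alpha]. *)
  have [yxv0|yxv0] := eqVneq (lact y (lact x v)) 0.
    have Lxy := lie_root Lx Ly.
    have [ba|/eqP ba] := eqVneq (beta - alpha) 0.
      by move/eqP: ba; rewrite subr_eq0 => /eqP ->.
    have Lba : Lambda (beta - alpha).
      apply: (root_systemI Lxy) => // xy0; move: xyv0.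
      by rewrite xyE yxv0 addr0 xy0 lact0l eqxx.
    rewrite -(subrK alpha beta) addrC; apply: CD => //; first exact: CP.
    by rewrite addrC subrK.
  (* Now [lact x v] is nonzero. Either [beta = - alpha], or [alpha + beta] is a weight and [beta] is
     reached from [alpha] by adding the root [beta], then the root [- alpha]. *)
  have [ab|/eqP ab] := eqVneq (alpha + beta) 0.
    move/eqP: ab; rewrite addrC addr_eq0 => /eqP ->.
    by apply: CN => //; apply: CP.
  have Pab : P (alpha + beta).
    have Vxv := lact_weight Lx Vv; rewrite addrC in Vxv.
    apply: (weight_systemI Vxv) => // xv0; move: yxv0.
    by rewrite xv0 lact0r eqxx.
  have Cab : C (alpha + beta) by apply: CD => //; apply: CP.
  have bE : beta = alpha + beta - alpha by rewrite addrC addKr.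
  by rewrite bE; apply: CD => //; [apply: roots_sym | rewrite -bE].
- move=> delta Cd v Vv /=; have Vxv := lact_weight Lx Vv.
  (* Landing in weight zero means [beta = - delta], and the image is then one of the products
     generating the first summand. *)
  have [bd|/eqP bd] := eqVneq (beta + delta) 0.
    move/eqP: bd; rewrite addr_eq0 => /eqP bd.
    apply: (@class_module_prod _ delta) => //; last by rewrite -bd.
    by rewrite -[delta]opprK -bd; apply: roots_sym.
  have [->//|Pbd] := weight_zero_or bd Vxv.
  apply: (class_module_weight _ Vxv); rewrite addrC in Pbd *.
  by apply: CD => //; apply: CP.
Qed.

(** Spanning by weight vectors gives the sum; directness is inherited from [V], since weights and
    weight spaces of [W] are contained in those of [V]. *)
Lemma weight_module_of_homogeneous W : subspace W ->
  W `<=` lin_span [set v | exists gamma : H -> K, weight_space W gamma v] ->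
  is_weight_module H W.
Proof.
move=> sW WG; have [_ dV] := V_weight; split.
  rewrite eqEsubset; split.
    by apply: sum_sub_min => // gamma _ v [].
  apply: (subset_trans WG); apply: lin_span_min; first exact: subspace_span.
  by move=> v [gamma]; apply: weight_space_sum.
have WP : 0 |` weight_system H W `<=` 0 |` P.
  move=> gamma [->|[dg g0 Wg]]; [by left | right; split=> // Vg].
  apply: Wg; rewrite eqEsubset; split=> [v [Wv hv]|_ ->].
    by rewrite -Vg.
  by case: (subspace_weight_space gamma sW).
move=> gamma Dg; rewrite eqEsubset; split=> [v [[Wv hv] Sv]|_ ->]; last first.
  by split; [case: (subspace_weight_space gamma sW) | exact: lin_span0].
rewrite -(dV gamma (WP _ Dg)); split=> //.
have sV := @subspace_span _ _ (\bigcup_(i in (0 |` P) `\ gamma) V_ i).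
apply: sum_sub_min Sv => // delta [/WP Dd dg] u [_ hu].
by apply: (@sum_sub_sub _ _ _ _ _ delta).
Qed.

Lemma weight_module_class_module C : is_weight_module H (class_module H V C).
Proof.
have sW := subspace_class_module C.
apply: weight_module_of_homogeneous => //.
apply: class_module_min => [|alpha x v La Ca Lx Vv|delta Cd v Vv].
- exact: subspace_span.
- apply: lin_span_sub; exists 0; split; first exact: class_module_prod Lx Vv.
  by case: (lact_opp_weight Lx Vv).
- apply: lin_span_sub; exists delta; split; last by case: Vv.
  exact: class_module_weight Vv.
Qed.

(** Here [W] stands for the sum of the other class modules and [D] for a set containing their
    weights. Stability of both submodules under root vectors brings the question back to nonzero
    weights, where [C] and [D] are disjoint. *)
Lemma class_submodules_disjoint C D (W : set V) v :
  module_center V = [set 0] -> C `<=` P -> D `<=` P -> C `&` D `<=` set0 ->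
  submodule (class_module H V C) -> submodule W -> W `<=` sum_sub (0 |` D) V_ ->
  class_module H V C v -> W v -> v = 0.
Proof.
move=> ZV CP DP CD subC subW WD Cv Wv.
have P0 delta : P delta -> delta <> 0 by case.
have [a [b [Aa Cb vE]]] := Cv.
have Va : V_ 0 a.
  apply: sum_sub_min Aa; first exact: subspace_V.
  move=> alpha [La Ca]; apply: lin_span_min; first exact: subspace_V.
  by move=> _ [x Lx [u Vu <-]]; apply: lact_opp_weight Lx Vu.
(* The part [b] has its weights in [C], while [v - a] has its weights in [D] or equal to zero. *)
have b0 : b = 0.
  apply: (@disjoint_weights C (0 |` D)) => // [|gamma [->|/DP]||].
  - by move=> gamma /CP; right.
  - by left.
  - by right.
  - by move=> gamma [Cg [g0|Dg]]; [case: (P0 _ (CP _ Cg)) | apply: (CD gamma)].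
  have -> : b = v - a by rewrite vE addrC addKr.
  apply: subspaceB; [exact: subspace_span | exact: WD |].
  by apply: (sum_sub_sub (i := 0)) => //; left.
have Vv : V_ 0 v by rewrite vE b0 addr0.
suff : module_center V v by rewrite ZV.
apply: (lie_algebra_ind H_cartan (Q := [set x | lact x v = 0])).
- exact: subspace_ker (lact_linearl v).
- by move=> h; apply: cartan_weight0.
move=> beta Lb x Lx /=.
have Vxv : V_ beta (lact x v) by rewrite -[beta]addr0; apply: lact_weight.
have b_neq0 : beta <> 0 by case: Lb.
have [//|Pb] := weight_zero_or b_neq0 Vxv.
have Sxv : sum_sub [set beta] V_ (lact x v) by apply: sum_sub_sub Vxv.
have sbP : [set beta] `<=` 0 |` P by move=> _ ->; right.
(* The nonzero weight [beta] is missing from [D] in the first case and from [C] in the second, so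
   one of the two submodules containing [lact x v] forces it to vanish. *)
have [Cb'|nCb] := pselect (C beta).
  apply: (disjoint_weights V_weight sbP _ _ Sxv (WD _ (proj2 subW x _ Wv))).
    by move=> gamma [->|/DP]; [left|right].
  by move=> _ [-> [//|Db]]; apply: (CD beta).
apply: (disjoint_weights V_weight sbP _ _ Sxv
  (class_module_sum (proj2 subC x _ Cv))).
  by move=> gamma [->|/CP]; [left|right].
by move=> _ [-> [//|]].
Qed.

Lemma sum_class_modules : prod_sub [set: L] [set: V] = [set: V] ->
  sum_sub (weight_classes H V) (class_module H V) = [set: V].
Proof.
set S := sum_sub _ _ => LV.
have sS : subspace S by exact: subspace_span.
have PS delta : P delta -> class_module H V (weight_class V delta) `<=` S.
  by move=> Pd; apply: sum_sub_sub; exists delta.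
have VS delta : delta <> 0 -> V_ delta `<=` S.
  move=> d0 v Vv; have [->|Pd] := weight_zero_or d0 Vv; first by case: sS.
  by apply: (PS _ Pd); apply: class_module_weight Vv; split=> //; apply: Or31.
rewrite eqEsubset; split=> //; rewrite -LV; apply: lin_span_min => //.
move=> _ [x _ [v _ <-]]; have : sum_sub (0 |` P) V_ v.
  by case: V_weight => -> _.
move: v; apply: (sum_sub_min (subspace_lact x sS)) => gamma _ v Vv /=.
move: x; apply: (lie_algebra_ind H_cartan); first exact: subspace_lact_l.
  move=> h /=; have [g0|/eqP g0] := eqVneq gamma 0.
    by rewrite g0 in Vv; rewrite (cartan_weight0 h Vv); case: sS.
  by case: (Vv) => _ ->; apply: subspaceZ => //; apply: VS Vv.
move=> beta Lb x Lx /=; have Vxv := lact_weight Lx Vv.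
(* Only weight zero needs care: then [beta = - gamma], so [gamma] is a root by symmetry, and
   [lact x v] is a generator of the module of the class of [gamma] unless [v] is zero. *)
have [bg|/eqP bg] := eqVneq (beta + gamma) 0; last exact: VS Vxv.
move/eqP: bg; rewrite addr_eq0 => /eqP bg.
have Lg : Lambda gamma by rewrite -[gamma]opprK -bg; apply: roots_sym.
have g0 : gamma <> 0 by case: Lg.
have [->|Pg] := weight_zero_or g0 Vv; first by rewrite lact0r; case: sS.
apply: (PS _ Pg).
apply: (@class_module_prod _ gamma) => //; last by rewrite -bg.
by split=> //; apply: Or31.
Qed.

End ClassModules.

End WeightModules.

Theorem theorem2p2 (K : fieldType) (L : lieAlgType K)
    (HS : {pred L}) (H : subLmodType HS) (V : lieModType L)
    (H_cartan : splitting_cartan [set x : L | x \in HS])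
    (roots_sym : symmetric_set (root_system H))
    (V_weight : is_weight_module H [set: V])
    (weights_sym : symmetric_set (weight_system H [set: V]))
    (LV : prod_sub [set: L] [set: V] = [set: V])
    (ZV : module_center V = [set 0]) :
  (forall C, weight_classes H V C ->
     weight_submodule H (class_module H V C)) /\
  is_direct_sum (weight_classes H V) (class_module H V) [set: V].
Proof.
have classP C : weight_classes H V C -> C `<=` weight_system H [set: V].
  by move=> [gamma Pg <-] delta [].
have subC C : weight_classes H V C -> submodule (class_module H V C).
  move=> CC; apply: submodule_class_module => //; first exact: classP.
  by have [gamma Pg <-] := CC; apply: step_closed_class.
split=> [C CC|].
  by split; [exact: subC | exact: weight_module_class_module].
split; first exact: sum_class_modules.
move=> C CC; set W := sum_sub _ _; have sW : subspace W by exact: subspace_span.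
rewrite eqEsubset; split=> [v [Cv Wv]|_ ->]; last first.
  by split; [case: (subC _ CC) => -[] | case: sW].
(* All weights outside [C] are taken as [D], since the classes different from [C] are disjoint from
   it. *)
apply: (@class_submodules_disjoint _ _ _ H V H_cartan V_weight C
  (weight_system H [set: V] `\` C) W) => //; try exact: subC; try exact: classP.
- by move=> gamma [Cg []].
- split=> // x; apply: sum_sub_min; first exact: subspace_lact.
  move=> D DD v' Dv; apply: (sum_sub_sub DD).
  by case: (subC D) => [|_]; [case: DD | apply].
- apply: sum_sub_min; first exact: subspace_span.
  move=> D [DD DC]; apply: (subset_trans (@class_module_sum _ _ _ _ _ D)).
  apply: sum_subS => delta [->|Dd]; [by left | right].
  split; first exact: classP Dd.
  move=> Cd; apply: DC; case: DD Dd => g Pg <- gd; case: CC Cd => g' Pg' <- g'd.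
  exact: weight_class_eq gd g'd.
Qed.
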